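(* Let $X$ be a nonempty finite set and let $\theta_X$ be a formigram over $X$ with bounded support and with critical points in $\mathbb{Z}$. Then for every $I\in\mathcal{I}$, $$\Diamond_I\theta_X=\sum_{J\in\mathcal{I},\,J\supset I}\mathrm{dgm}^{\Diamond}(\theta_X)(J)\quad\text{in }\mathbb{Z}\,\mathrm{pow}(X),$$ and in particular, for every $t\in\mathbb{R}$, $\theta_X(t)=\sum_{J\in\mathcal{I},\,J\ni t}\mathrm{dgm}^{\Diamond}(\theta_X)(J)$ (where $\theta_X(t)$ is viewed in $\mathbb{Z}\,\mathrm{pow}(X)$). Thus $\theta_X$ can be recovered from its persistence clustergram $\mathrm{dgm}^{\Diamond}(\theta_X)$: two such formigrams over $X$ with the same persistence clustergram are equal.
   Context: Subpartitions. A subpartition of $X$ is a partition $P$ of a (possibly empty) subset of $X$ (the partition of $\emptyset$ is $\emptyset$). Its elements are called blocks and $\bigcup P$ is its underlying set. $\mathrm{SubPart}(X)$ is the set of all subpartitions of $X$, ordered by $P\le Q$ iff every block of $P$ is contained in some block of $Q$. It is a lattice: $P\vee Q$ is the finest common coarsening and $P\wedge Q$ the coarsest common refinement (blocks: nonempty intersections of a block of $P$ and a block of $Q$). Formigrams. A formigram over $X$ is a map $\theta_X:\mathbb{R}\to\mathrm{SubPart}(X)$ such that (a) there is a locally finite set $C\subset\mathbb{R}$ of ''critical points'' such that $\theta_X$ is constant on each connected component of $\mathbb{R}\setminus C$ and every $c\in C$ is locally maximal, i.e. there is $r_c>0$ with $\theta_X(c-\varepsilon)\le\theta_X(c)\ge\theta_X(c+\varepsilon)$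 for all $\varepsilon\in[0,r_c)$; (b) for each $x\in X$ there is a (nonempty) closed interval $I_x\subset\mathbb{R}$ (lifespan) with $x\in\bigcup\theta_X(t)$ iff $t\in I_x$. The support of $\theta_X$ is $\bigcup_{x}I_x$. ''Critical points in $\mathbb{Z}$'' means that $C\subset\mathbb{Z}$ can be chosen. $\mathcal{I}$ denotes the set of all nonempty bounded intervals of $\mathbb{R}$ (open, closed or half-open) with integer endpoints, ordered by inclusion. For $I\in\mathcal{I}$, $I^-$ is the smallest element of $\mathcal{I}$ strictly enlarging $I$ only on the left (a left end ''$(b$'' becomes ''$[b$'', a left end ''$[b$'' becomes ''$(b-1$''); $I^+$ is the smallest element strictly enlarging $I$ only on the right (''$d)$'' becomes ''$d]$'', ''$d]$'' becomes ''$d+1)$''); $I^{\pm}=I^-\cup I^+$. For an interval $I$, let $\bigwedge_I\theta_X=\bigwedge\{\theta_X(t):t\in I\}$, $\bigvee_I\theta_X=\bigvee\{\theta_X(t):t\in I\}$, let $X'=\bigcup\big(\bigwedge_I\theta_X\big)$ and $$\Diamond_I\theta_X:=\Big\{B\cap X' : B\in\textstyle\bigvee_I\theta_X,\ B\cap X'\ne\emptyset\Big\}\in\mathrm{SubPart}(X).$$ $\mathbb{Z}\,\mathrm{pow}(X)$ is the free abelian group on the power set of $X$; a subpartition $\{B_i\}_i$ is identified with $\sum_i 1\cdot B_i$. The persistence clustergram of $\theta_X$ is the map $\mathrm{dgm}^{\Diamond}(\theta_X):\mathcal{I}\to\mathbb{Z}\,\mathrm{pow}(X)$, $$\mathrm{dgm}^{\Diamond}(\theta_X)(I)=\Diamond_I\theta_X-\Diamond_{I^+}\theta_X-\Diamond_{I^-}\theta_X+\Diamond_{I^\pm}\theta_X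 .$$ *)

(* Defs.v *)
From HB Require Import structures.
From mathcomp Require Import all_boot all_order all_algebra.

Set Implicit Arguments.
Unset Strict Implicit.
Unset Printing Implicit Defensive.

Import Order.TTheory GRing.Theory Num.Theory.

Local Open Scope ring_scope.

(* An element of SubPart(X) is its finite set of blocks. *)
Definition is_subpart (X : finType) (P : {set {set X}}) : bool :=
  trivIset P && (set0 \notin P).

Record subpart (X : finType) : predArgType :=
  SubPart { blocks :> {set {set X}}; _ : is_subpart blocks }.

HB.instance Definition _ (X : finType) := [isSub for @blocks X].
HB.instance Definition _ (X : finType) := [Finite of subpart X by <:].

Section SubPartLattice.
Variable X : finType.
Implicit Types (P Q S : subpart X) (A B C D : {set X}).

Definition underlying P : {set X} := cover (blocks P).

Definition sple P Q : bool := [forall B in blocks P, exists C in blocks Q, B \subset C].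

Lemma spleP P Q : reflect
  (forall B, B \in blocks P -> exists2 C, C \in blocks Q & B \subset C) (sple P Q).
Proof.
apply: (iffP forall_inP) => h B /h.
  by move=> /exists_inP [C CQ BC]; exists C.
by move=> [C CQ BC]; apply/exists_inP; exists C.
Qed.

Lemma block_n0 P B : B \in blocks P -> exists x, x \in B.
Proof.
case: P => P /= /andP [_ P0] BP; apply/set0Pn.
by apply: contraNneq P0 => <-.
Qed.

Lemma block_eq P B C x : B \in blocks P -> C \in blocks P ->
  x \in B -> x \in C -> B = C.
Proof.
case: P => P /= /andP [tP _] BP CP xB xC.
by rewrite -(def_pblock tP BP xB) (def_pblock tP CP xC).
Qed.

Lemma is_subpartP (P : {set {set X}}) :
  (forall B, B \in P -> exists x, x \in B) ->
  (forall B C x, B \in P -> C \in P -> x \in B -> x \in C -> B = C) ->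
  is_subpart P.
Proof.
move=> h0 h; apply/andP; split.
  apply/trivIsetP => B C BP CP /eqP BC.
  rewrite -setI_eq0; apply/eqP/setP => x; rewrite !inE.
  by apply/negP => /andP [xB xC]; apply: BC; apply: (h _ _ x).
by apply/negP => /h0 [x]; rewrite inE.
Qed.

Fact sple_refl : reflexive sple.
Proof. by move=> P; apply/spleP => B BP; exists B. Qed.

Fact sple_anti : antisymmetric sple.
Proof.
have sub P Q : sple P Q -> sple Q P -> {subset blocks P <= blocks Q}.
  move=> /spleP PQ /spleP QP B BP.
  have [C CQ BC] := PQ B BP; have [B' B'P CB'] := QP C CQ.
  have [x xB] := block_n0 BP.
  have E : B = B' by apply: (block_eq BP B'P xB); apply: (subsetP CB'); apply: (subsetP BC).
  suff -> : B = C by [].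
  by apply/eqP; rewrite eqEsubset BC E.
move=> P Q /andP [PQ QP]; apply/val_inj/setP => B /=.
by apply/idP/idP; apply: sub.
Qed.

Fact sple_trans : transitive sple.
Proof.
move=> Q P S /spleP PQ /spleP QS; apply/spleP => B /PQ [C /QS [D DS CD] BC].
by exists D => //; apply: subset_trans CD.
Qed.

Fact subpart_display : Order.disp_t. Proof. exact: Order.Disp tt tt. Qed.

HB.instance Definition _ :=
  Order.Le_isPOrder.Build subpart_display (subpart X) sple_refl sple_anti sple_trans.

Definition spmeet_blocks P Q : {set {set X}} :=
  ([set B :&: C | B in blocks P, C in blocks Q] :\ set0)%SET.

Fact spmeet_subproof P Q : is_subpart (spmeet_blocks P Q).
Proof.
apply: is_subpartP => [D|D D' x].
  by rewrite !inE => /andP [/set0Pn].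
rewrite !inE => /andP [_ /imset2P [B C BP CQ ->]] /andP [_ /imset2P [B' C' BP' CQ' ->]].
rewrite !inE => /andP [xB xC] /andP [xB' xC'].
by rewrite (block_eq BP BP' xB xB') (block_eq CQ CQ' xC xC').
Qed.

Definition spmeet P Q := SubPart (spmeet_subproof P Q).

(* The blocks of the join are the classes of the equivalence
   relation generated by lying in a common block of [P] or of [Q]. *)
Definition same_block (P : {set {set X}}) : rel X :=
  fun x y => [exists B in P, (x \in B) && (y \in B)].

Definition spjoin_blocks P Q : {set {set X}} :=
  equivalence_partition (connect (same_block (blocks P :|: blocks Q)%SET))
    (cover (blocks P :|: blocks Q)%SET).

Lemma same_block_equiv (P : {set {set X}}) (D : {set X}) :
  {in D & &, equivalence_rel (connect (same_block P))}.
Proof.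
have s : connect_sym (same_block P).
  apply: sym_connect_sym => x y.
  by apply: eq_existsb => B; rewrite [(x \in B) && _]andbC.
move=> x y z _ _ _; split; first exact: connect0.
by move=> xy; apply/idP/idP; apply: connect_trans => //; rewrite s.
Qed.

Fact spjoin_subproof P Q : is_subpart (spjoin_blocks P Q).
Proof.
have /and3P [_ tP P0] := equivalence_partitionP
  (@same_block_equiv (blocks P :|: blocks Q)%SET (cover (blocks P :|: blocks Q)%SET)).
by apply/andP.
Qed.

Definition spjoin P Q := SubPart (spjoin_subproof P Q).

Fact le_spmeet P Q S : sple P (spmeet Q S) = sple P Q && sple P S.
Proof.
apply/spleP/andP => [h|[/spleP hQ /spleP hS]].
  split; apply/spleP => B /h [D]; rewrite inE => /andP [_ /imset2P [C C' CQ CS ->]].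
    by rewrite subsetI => /andP [BC _]; exists C.
  by rewrite subsetI => /andP [_ BC]; exists C'.
move=> B BP; have [C CQ BC] := hQ B BP; have [C' CS BC'] := hS B BP.
have BI : B \subset C :&: C' by rewrite subsetI BC.
exists (C :&: C')%SET => //; rewrite !inE; apply/andP; split; last exact: imset2_f.
by have [x xB] := block_n0 BP; apply/set0Pn; exists x; apply: (subsetP BI).
Qed.

Fact spjoin_le P Q S : sple (spjoin P Q) S = sple P S && sple Q S.
Proof.
set U := (blocks P :|: blocks Q)%SET.
have ub B : B \in U -> exists2 C, C \in blocks (spjoin P Q) & B \subset C.
  move=> BU; have [x xB] : exists x, x \in B.
    by move: BU; rewrite inE => /orP [] /block_n0.
  have xU : x \in cover U by apply/bigcupP; exists B.
  exists [set y in cover U | connect (same_block U) x y]%SET; first by apply/imsetP; exists x.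
  apply/subsetP => y yB; rewrite inE; apply/andP; split; first by apply/bigcupP; exists B.
  by apply: connect1; apply/exists_inP; exists B => //; rewrite xB.
apply/idP/andP => [h|[/spleP hP /spleP hQ]].
  split; apply: (sple_trans (y := spjoin P Q)) => //; apply/spleP => B BP; apply: ub;
    by rewrite inE BP ?orbT.
apply/spleP => D /imsetP [x /bigcupP [B BU xB] ->].
have hU B' : B' \in U -> exists2 C, C \in blocks S & B' \subset C.
  by rewrite inE => /orP [/hP|/hQ].
have [C CS /subsetP BC] := hU B BU; exists C => //.
apply/subsetP => y; rewrite inE => /andP [_ /connectP [p]].
have := BC x xB; elim: p x {B BU xB BC} => [|z p IH] x xC /=; first by move=> _ ->.
move=> /andP [/exists_inP [B BU /andP [xB zB]] zp] yl; apply: (IH z) => //.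
have [C' CS' /subsetP BC] := hU B BU.
by rewrite (block_eq CS CS' xC (BC x xB)) BC.
Qed.

HB.instance Definition _ := Order.POrder_MeetJoin_isLattice.Build
  subpart_display (subpart X) le_spmeet spjoin_le.

Fact spbot_subproof : is_subpart (set0 : {set {set X}}).
Proof. by apply: is_subpartP => [B|B C x]; rewrite inE. Qed.

Fact sptop_subproof : is_subpart ([set setT] :\ set0 : {set {set X}})%SET.
Proof.
apply: is_subpartP => [B|B C x]; rewrite !inE; first by move=> /andP [/set0Pn].
by move=> /andP [_ /eqP ->] /andP [_ /eqP ->].
Qed.

Fact spbot_le P : sple (SubPart spbot_subproof) P.
Proof. by apply/spleP => B; rewrite inE. Qed.

Fact sptop_ge P : sple P (SubPart sptop_subproof).
Proof.
apply/spleP => B BP; exists setT; last exact: subsetT.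
by have [x xB] := block_n0 BP; rewrite !inE eqxx andbT; apply/set0Pn; exists x; rewrite inE.
Qed.

HB.instance Definition _ :=
  Order.hasBottom.Build subpart_display (subpart X) spbot_le.
HB.instance Definition _ :=
  Order.hasTop.Build subpart_display (subpart X) sptop_ge.

(* The nonempty traces on [A] of the blocks of [P]. *)
Definition restr_blocks P A : {set {set X}} :=
  ([set B :&: A | B in blocks P] :\ set0)%SET.

Fact restr_subproof P A : is_subpart (restr_blocks P A).
Proof.
apply: is_subpartP => [D|D D' x].
  by rewrite !inE => /andP [/set0Pn].
rewrite !inE => /andP [_ /imsetP [B BP ->]] /andP [_ /imsetP [B' BP' ->]].
rewrite !inE => /andP [xB xC] /andP [xB' xC'].
by rewrite (block_eq BP BP' xB xB').
Qed.

Definition restr P A := SubPart (restr_subproof P A).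

End SubPartLattice.

From mathcomp Require Import all_classical all_reals.
From mathcomp Require Import topology normedtype.
From mathcomp.multinomials Require Import freeg.
From mathcomp Require Import lra.
Import numFieldNormedType.Exports.
Local Open Scope classical_set_scope.

Section Formigrams.
Variables (R : realType) (X : finType).
Implicit Types (theta : R -> subpart X) (C A : set R).

Definition locally_finite C : Prop :=
  forall t : R, exists2 U, nbhs t U & finite_set (U `&` C).

(* [C] is an admissible set of critical points for [theta]. *)
Definition critical_set theta C : Prop :=
  [/\ locally_finite C,
      forall s t, connected_component (~` C) s t -> theta s = theta t &
      forall c, C c -> exists2 r, 0 < r & forall e, 0 <= e < r ->
        (theta (c - e)%R <= theta c)%O /\ (theta (c + e)%R <= theta c)%O].

(* The only possible choice for the interval I_x. *)
Definition lifespan theta (x : X) : set R :=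
  [set t | x \in underlying (theta t)].

Definition formigram theta : Prop :=
  (exists C, critical_set theta C) /\
  forall x, [/\ lifespan theta x !=set0, closed (lifespan theta x) &
                is_interval (lifespan theta x)].

Definition critical_in_Z theta : Prop :=
  exists2 C, critical_set theta C & C `<=` [set c | c \is a Num.int].

Definition formigram_support theta : set R := \bigcup_(x in [set: X]) lifespan theta x.

(* The values of [theta] on [A] form a subset of the finite lattice [subpart X],
   so these are the meet and the join of all [theta t], t in [A]. *)
Definition bigmeet theta A : subpart X :=
  (\meet_(P : subpart X | P \in theta @` A) P)%O.

Definition bigjoin theta A : subpart X :=
  (\join_(P : subpart X | P \in theta @` A) P)%O.

Definition diamond theta A : subpart X :=
  restr (bigjoin theta A) (underlying (bigmeet theta A)).

End Formigrams.

Section IntegerIntervals.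
Variable R : realType.

(* The endpoints are unique for a nonempty interval, so syntactic intervals
   correspond bijectively to subsets of the line here. *)
Definition is_zitv (i : interval R) : bool :=
  match i with
  | Interval (BSide _ a) (BSide _ b) =>
      [&& a \is a Num.int, b \is a Num.int & `[< [set` i] !=set0 >]]
  | _ => false
  end.

Record zitv : predArgType := Zitv { zitv_val : interval R; _ : is_zitv zitv_val }.

HB.instance Definition _ := [isSub for zitv_val].
HB.instance Definition _ := [Choice of zitv by <:].

Definition zset (I : zitv) : set R := [set` zitv_val I].

(* As a lower end, [BLeft a] is "[a" and [BRight a] is "(a". *)
Definition lower_step (k : itv_bound R) : itv_bound R :=
  match k with
  | BLeft a => BRight (a - 1)
  | BRight a => BLeft a
  | BInfty _ => k
  end.

(* As an upper end, [BLeft d] is "d)" and [BRight d] is "d]". *)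
Definition upper_step (k : itv_bound R) : itv_bound R :=
  match k with
  | BLeft d => BRight d
  | BRight d => BLeft (d + 1)
  | BInfty _ => k
  end.

Definition itv_left (i : interval R) : interval R :=
  let: Interval l u := i in Interval (lower_step l) u.

Definition itv_right (i : interval R) : interval R :=
  let: Interval l u := i in Interval l (upper_step u).

Fact lower_step_le k : (lower_step k <= k)%O.
Proof. by case: k => [[] a|b] //=; rewrite ?bnd_simp ?lexx //; lra. Qed.

Fact upper_step_ge k : (k <= upper_step k)%O.
Proof. by case: k => [[] a|b] //=; rewrite ?bnd_simp ?lexx //; lra. Qed.

Fact itv_left_subproof (I : zitv) : is_zitv (itv_left (zitv_val I)).
Proof.
case: I => [[[bl a|//] [br b|//]]] /= /and3P [za zb /asboolP [t It]].
have ne : [set` Interval (lower_step (BSide bl a)) (BSide br b)] !=set0.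
  by exists t; apply: (subset_itv (lower_step_le _) (lexx _) It).
case: bl {It} ne => /= ne; apply/and3P; split=> //; try exact/asboolP.
by rewrite rpredB ?rpred1.
Qed.

Fact itv_right_subproof (I : zitv) : is_zitv (itv_right (zitv_val I)).
Proof.
case: I => [[[bl a|//] [br b|//]]] /= /and3P [za zb /asboolP [t It]].
have ne : [set` Interval (BSide bl a) (upper_step (BSide br b))] !=set0.
  by exists t; apply: (subset_itv (lexx _) (upper_step_ge _) It).
case: br {It} ne => /= ne; apply/and3P; split=> //; try exact/asboolP.
by rewrite rpredD ?rpred1.
Qed.

(* [zleft I] is I^- and [zright I] is I^+. *)
Definition zleft (I : zitv) : zitv := Zitv (itv_left_subproof I).
Definition zright (I : zitv) : zitv := Zitv (itv_right_subproof I).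

End IntegerIntervals.

Coercion zset : zitv >-> set.

(* The sum of the blocks of [P] in the free abelian group on the subsets of X. *)
Definition to_Zpow (X : finType) (P : subpart X) : {freeg {set X} / int} :=
  \sum_(B in blocks P) << B >>.

Definition dgm (R : realType) (X : finType) (theta : R -> subpart X)
    (I : zitv R) : {freeg {set X} / int} :=
  to_Zpow (diamond theta I)
  - to_Zpow (diamond theta (zright I))
  - to_Zpow (diamond theta (zleft I))
  + to_Zpow (diamond theta ((zleft I : set R) `|` zright I)).

(* Main.v *)
Require Import Defs.
From mathcomp Require Import all_boot all_order all_algebra.
From mathcomp Require Import all_classical all_reals.
From mathcomp Require Import topology normedtype.
From mathcomp.multinomials Require Import freeg.
From mathcomp Require Import lra.

Set Implicit Arguments.
Unset Strict Implicit.
Unset Printing Implicit Defensive.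

Import Order.TTheory GRing.Theory Num.Theory.
Import numFieldNormedType.Exports.

Local Open Scope classical_set_scope.
Local Open Scope ring_scope.

(* Every J containing I is obtained from I by a unique number i of left steps
   and j of right steps, so over the J containing I the clustergram is a mixed
   second difference in (i, j) of J |-> diamond J, and its sum telescopes. The
   boundary terms vanish: once i or j is large, J leaves the bounded support,
   where theta is empty, so diamond J is empty. To evaluate at t, take for I the
   least element of zitv containing t, namely {t} or an open unit interval; theta
   is constant there, so diamond I = theta t. *)

(** * Integer endpoints and the half steps that move them *)

Section Intervals.
Variable R : realType.
Implicit Types (I J : zitv R) (a c s t : R) (k l u : itv_bound R).

Lemma lower_stepK : cancel (@lower_step R) (@upper_step R).
Proof. by case=> [[] a|b] //=; rewrite subrK. Qed.

(* Each step moves an end by one half in the scale where "a-" has position [a]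
   and "a+" has position [a + 1/2]; the positions are doubled here. *)
Lemma iter_lower_stepP i (b : bool) a : exists b' c,
  iter i (@lower_step R) (BSide b a) = BSide b' c /\
  c *+ 2 + (~~ b')%:R = a *+ 2 + (~~ b)%:R - i%:R.
Proof.
elim: i => [|i [b' [c [/= -> E]]]]; first by exists b, a; rewrite subr0.
move: E; case: b' => /= E; [exists false, (c - 1)|exists true, c]; split=> //=;
  rewrite -natr1; lra.
Qed.

Lemma iter_upper_stepP i (b : bool) a : exists b' c,
  iter i (@upper_step R) (BSide b a) = BSide b' c /\
  c *+ 2 + (~~ b')%:R = a *+ 2 + (~~ b)%:R + i%:R.
Proof.
elim: i => [|i [b' [c [/= -> E]]]]; first by exists b, a; rewrite addr0.
move: E; case: b' => /= E; [exists false, c|exists true, (c + 1)]; split=> //=;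
  rewrite -natr1; lra.
Qed.

(** Equal bounds have equal positions, and the position after [i] steps determines [i]. *)
Lemma iter_lower_step_inj (b : bool) a :
  injective (fun i => iter i (@lower_step R) (BSide b a)).
Proof.
move=> i j /=.
have [b1 [c1 [-> E1]]] := iter_lower_stepP i b a.
have [b2 [c2 [-> E2]]] := iter_lower_stepP j b a.
case=> eb ec; subst b2 c2.
by apply/eqP; rewrite -(eqr_nat R); apply/eqP; lra.
Qed.

Lemma iter_upper_step_inj (b : bool) a :
  injective (fun i => iter i (@upper_step R) (BSide b a)).
Proof.
move=> i j /=.
have [b1 [c1 [-> E1]]] := iter_upper_stepP i b a.
have [b2 [c2 [-> E2]]] := iter_upper_stepP j b a.
case=> eb ec; subst b2 c2.
by apply/eqP; rewrite -(eqr_nat R); apply/eqP; lra.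
Qed.

(** The open/closed flags shift the doubled position by at most 1, so the margin [2] puts the new
    endpoint strictly below [s], whichever side it has. *)
Lemma iter_lower_step_far i (b : bool) a s : (a - s) *+ 2 + 2 < i%:R ->
  (iter i (@lower_step R) (BSide b a) <= BLeft s)%O.
Proof.
have [b' [c [-> E]]] := iter_lower_stepP i b a.
move=> h; have cs : c < s by move: E; case: b b' => [] [] /=; lra.
by case: b' {E}; rewrite bnd_simp // ltW.
Qed.

Lemma iter_upper_step_far i (b : bool) a s : (s - a) *+ 2 + 2 < i%:R ->
  (BRight s <= iter i (@upper_step R) (BSide b a))%O.
Proof.
have [b' [c [-> E]]] := iter_upper_stepP i b a.
move=> h; have cs : s < c by move: E; case: b b' => [] [] /=; lra.
by case: b' {E}; rewrite bnd_simp // ltW.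
Qed.

Lemma iter_lower_step_double n (b : bool) a :
  iter n.*2 (@lower_step R) (BSide b a) = BSide b (a - n%:R).
Proof.
elim: n => [|n IH]; first by rewrite subr0.
by rewrite doubleS !iterS IH -natr1; case: b {IH} => /=; congr BSide; lra.
Qed.

Lemma lower_step_reach (b b' : bool) a c :
  a \is a Num.int -> c \is a Num.int -> (BSide b' c <= BSide b a)%O ->
  exists i, BSide b' c = iter i (@lower_step R) (BSide b a).
Proof.
move=> za zc h.
have ca : c <= a by move: h; case: b b' => [] []; rewrite bnd_simp // => /ltW.
have /natrP [n En] : a - c \is a Num.nat by rewrite natrEint rpredB //= subr_ge0.
have Ec : c = a - n%:R by lra.
case: b b' h => [] [] h.
- by exists n.*2; rewrite iter_lower_step_double Ec.
(* From [BLeft a] down to [BRight c] takes one half step fewer than twice [a - c]; this distance is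
   positive since [BRight a] lies above [BLeft a]. *)
- case: n En Ec => [En|n _ ->]; first by move: h; rewrite bnd_simp; lra.
  by exists (n.*2.+1); rewrite iterS iter_lower_step_double /= -natr1; congr BSide; lra.
- by exists (n.*2.+1); rewrite iterS iter_lower_step_double /= Ec.
- by exists n.*2; rewrite iter_lower_step_double Ec.
Qed.

(** By [lower_stepK], the descent from the larger bound to the smaller one can be undone in the same
    number of steps. *)
Lemma upper_step_reach (b b' : bool) a c :
  a \is a Num.int -> c \is a Num.int -> (BSide b a <= BSide b' c)%O ->
  exists i, BSide b' c = iter i (@upper_step R) (BSide b a).
Proof.
move=> za zc /(lower_step_reach zc za) [i ->]; exists i.
by elim: i (BSide b' c) => [|i IH] k //; rewrite iterSr [iter i.+1 _ k]iterS lower_stepK -IH.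
Qed.

(** * Coordinates [(i, j)] on the intervals containing [I] *)

Definition zexpand I i j : zitv R := iter i (@zleft R) (iter j (@zright R) I).

Lemma zleft_val I :
  zitv_val (zleft I) = Interval (lower_step (zitv_val I).1) (zitv_val I).2.
Proof. by case: I => -[]. Qed.

Lemma zright_val I :
  zitv_val (zright I) = Interval (zitv_val I).1 (upper_step (zitv_val I).2).
Proof. by case: I => -[]. Qed.

Lemma zleft_zright I : zleft (zright I) = zright (zleft I).
Proof. by apply/val_inj; case: I => -[]. Qed.

Lemma zleft_expand I i j : zleft (zexpand I i j) = zexpand I i.+1 j.
Proof. by []. Qed.

Lemma zright_expand I i j : zright (zexpand I i j) = zexpand I i j.+1.
Proof. by rewrite /zexpand; elim: i => [|i IH] //=; rewrite -zleft_zright IH. Qed.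

Lemma zexpand_val I i j : zitv_val (zexpand I i j) =
  Interval (iter i (@lower_step R) (zitv_val I).1)
           (iter j (@upper_step R) (zitv_val I).2).
Proof.
rewrite /zexpand; elim: i => [|i IH]; last by rewrite iterS zleft_val IH.
elim: j => [|j IH]; last by rewrite iterS zright_val IH.
by case: (zitv_val I).
Qed.

Lemma zitvP I : exists b a b' c, [/\ zitv_val I = Interval (BSide b a) (BSide b' c),
  a \is a Num.int, c \is a Num.int & (I : set R) !=set0].
Proof.
case: I => -[[b a|?] [b' c|?]] //= h.
by exists b, a, b', c; rewrite /zset /=; case/and3P: (h) => za zc /asboolP ne.
Qed.

(** As [I] is nonempty and the line is dense, an end of [J] strictly inside the corresponding end of
    [I] would leave a point of [I] outside [J]. *)
Lemma zsubP I J : (I : set R) `<=` J <->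
  ((zitv_val J).1 <= (zitv_val I).1)%O /\ ((zitv_val I).2 <= (zitv_val J).2)%O.
Proof.
have [b [a [b' [c [E _ _ [t tI]]]]]] := zitvP I.
rewrite /zset in tI *; case: (zitv_val I) (zitv_val J) tI {E} => l u [l' u'] tI.
split=> /= [sub|[h1 h2]]; last exact: subset_itv.
move: (tI); rewrite /= itv_boundlr => /andP [lt tu].
split; rewrite leNgt; apply/negP => h.
  (* A point between [l] and [l'], capped by [u] to stay in [I], is missed by [J]. *)
  have /set0P [s /=] : neitv (Interval l (Order.min l' u)).
    by apply/neitvP; rewrite /= lt_min h (le_lt_trans lt) // (lt_le_trans _ tu) // bnd_simp.
  rewrite itv_boundlr le_min => /and3P [ls sl' su].
  have /= := sub s; rewrite !itv_boundlr ls su => /(_ isT) /andP [l's _].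
  by have := le_trans sl' l's; rewrite bnd_simp ltxx.
have /set0P [s /=] : neitv (Interval (Order.max l u') u).
  by apply/neitvP; rewrite /= gt_max h andbT (lt_le_trans _ tu) // (le_lt_trans lt) ?bnd_simp.
rewrite itv_boundlr ge_max => /andP [/andP [ls u's] su].
have /= := sub s; rewrite !itv_boundlr ls su => /(_ isT) /andP [_ su'].
by have := le_trans su' u's; rewrite bnd_simp ltxx.
Qed.

Lemma zexpandP I J :
  (I : set R) `<=` J <-> exists p : nat * nat, J = zexpand I p.1 p.2.
Proof.
have [b [a [b' [c [E za zc _]]]]] := zitvP I.
split=> [/zsubP|[[i j] ->] /=].
  have [b1 [a1 [b2 [c2 [E' za1 zc2 _]]]]] := zitvP J.
  rewrite E E' /= => -[/(lower_step_reach za za1) [i Ei]].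
  move=> /(upper_step_reach zc zc2) [j Ej]; exists (i, j).
  by apply/val_inj; rewrite /= zexpand_val E E' Ei Ej.
apply/zsubP; rewrite zexpand_val /=; split.
  by elim: i => //= i; apply: le_trans (lower_step_le _).
by elim: j => //= j /le_trans; apply; exact: upper_step_ge.
Qed.

Lemma zexpand_inj I : injective (fun p => zexpand I p.1 p.2).
Proof.
move=> [i j] [i' j'] /= /(congr1 (@zitv_val R)); rewrite !zexpand_val.
have [b [a [b' [c [-> _ _ _]]]]] := zitvP I => -[].
by move=> /(@iter_lower_step_inj b a) -> /(@iter_upper_step_inj b' c) ->.
Qed.

(** With [t] in [I] fixed, points up to [t] of the doubly extended interval lie in the left
    extension, points after [t] in the right one. The union in [dgm] is thus itself a [zitv]. *)
Lemma zleftU_zright I : (zleft I : set R) `|` zright I = zleft (zright I).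
Proof.
have [_ [_ [_ [_ [_ _ _ [t]]]]]] := zitvP I.
rewrite /zset !(zleft_val, zright_val); case: (zitv_val I) => l u /=.
rewrite itv_boundlr => /andP [lt tu].
apply/seteqP; split=> [s [|]|s] /=; rewrite !itv_boundlr => /andP [h1 h2].
- by rewrite h1 (le_trans h2) ?upper_step_ge.
- by rewrite (le_trans _ h1) ?lower_step_le.
have [st|ts] := leP s t.
  by left; rewrite h1 (le_trans _ tu) ?bnd_simp.
by right; rewrite h2 (le_trans lt) // bnd_simp ltW.
Qed.

Lemma zexpand_escape I M : exists N, forall i j, (N <= i)%N || (N <= j)%N ->
  exists2 s, (zexpand I i j : set R) s & M < `|s|.
Proof.
have [b [a [b' [c [E _ _ [t]]]]]] := zitvP I.
rewrite /zset /= E itv_boundlr => /andP [lt tu].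
(* Beyond the bound [M], and with [t] strictly between [- s] and [s]: an interval containing [t]
   whose lower end passes [- s] contains [- s], and likewise for [s] on the right. *)
pose s := `|M| + `|t| + 1.
have [ts st] : t < s /\ - s < t.
  by have := ler_norm t; have := ler_norm (- t); have := normr_ge0 M; rewrite normrN /s; lra.
have Ms : M < s by have := ler_norm M; have := normr_ge0 t; rewrite /s; lra.
have le0s : 0 <= s by have := normr_ge0 M; have := normr_ge0 t; rewrite /s; lra.
(* The two summands are the thresholds for a lower end to pass [- s] and for an upper end to pass
   [s]. *)
pose N := Num.bound (`|(a + s) *+ 2 + 2| + `|(s - c) *+ 2 + 2|).
have HN n : (N <= n)%N -> (a + s) *+ 2 + 2 < n%:R /\ (s - c) *+ 2 + 2 < n%:R.
  rewrite -(ler_nat R) => Nn.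
  have := archi_boundP (addr_ge0 (normr_ge0 ((a + s) *+ 2 + 2)) (normr_ge0 ((s - c) *+ 2 + 2))).
  rewrite -/N; have := ler_norm ((a + s) *+ 2 + 2); have := ler_norm ((s - c) *+ 2 + 2).
  by have := normr_ge0 ((a + s) *+ 2 + 2); have := normr_ge0 ((s - c) *+ 2 + 2); split; lra.
have lo i : (iter i (@lower_step R) (BSide b a) <= BSide b a)%O.
  by elim: i => //= i; apply: le_trans (lower_step_le _).
have up j : (BSide b' c <= iter j (@upper_step R) (BSide b' c))%O.
  by elim: j => //= j /le_trans; apply; exact: upper_step_ge.
exists N => i j /orP [] /HN [h1 h2].
  exists (- s); last by rewrite normrN ger0_norm.
  rewrite zexpand_val E /= itv_boundlr iter_lower_step_far ?opprK //=.
  by rewrite (le_trans _ (up j)) // (le_trans _ tu) // bnd_simp ltW.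
exists s; last by rewrite ger0_norm.
rewrite zexpand_val E /= itv_boundlr iter_upper_step_far // andbT.
by rewrite (le_trans (lo i)) // (le_trans lt) // bnd_simp ltW.
Qed.

(** * Moebius inversion by telescoping *)

Definition second_difference (V : zmodType) (f : zitv R -> V) J : V :=
  f J - f (zright J) - f (zleft J) + f (zleft (zright J)).

Lemma mobius_inversion (V : zmodType) (f : zitv R -> V) I N :
  (forall i j, (N <= i)%N || (N <= j)%N -> f (zexpand I i j) = 0) ->
  finite_set [set J : zitv R | (I : set R) `<=` J /\ second_difference f J != 0] /\
  f I = \sum_(J \in [set J : zitv R | (I : set R) `<=` J]) second_difference f J.
Proof.
move=> f0; set g := second_difference f.
pose F i j := f (zexpand I i j).
(* Grouped as a difference in [j] of differences in [i], ready to telescope in [j] first. *)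
have gE i j : g (zexpand I i j) = (F i.+1 j.+1 - F i j.+1) - (F i.+1 j - F i j).
  by rewrite /g /second_difference zright_expand !zleft_expand opprB [LHS]addrC -[RHS]addrA [- _ + (_ - _)]addrA
    [- _ + F i j]addrC.
(* The box of coordinates below [N]. Outside it, all four corners of the second difference have a
   coordinate at least [N], so [g] vanishes there. *)
pose r := [seq zexpand I p.1 p.2 | p <- [seq (i, j) | i <- iota 0 N, j <- iota 0 N]].
have gr J : (I : set R) `<=` J -> J \notin r -> g J = 0.
  move=> /zexpandP [[i j] ->] /= h.
  have {}h : (N <= i)%N || (N <= j)%N.
    apply: contraR h; rewrite negb_or -!ltnNge => /andP [iN jN].
    by apply/mapP; exists (i, j) => //; apply/allpairsP; exists (i, j); rewrite !mem_iota.
  by rewrite gE /F !f0 ?subr0 //; case/orP: h => h; rewrite ?h ?orbT ?(leqW h) ?orbT.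
split.
  apply: (sub_finite_set _ (finite_seq r)) => J [IJ] /=.
  by apply: contra_neqT; apply: gr.
have ur : uniq r.
  rewrite map_inj_uniq; last exact: zexpand_inj.
  by apply: allpairs_uniq; rewrite ?iota_uniq // => -[? ?] [? ?] _ _ [-> ->].
have rI : [set` r] `<=` [set J : zitv R | (I : set R) `<=` J].
  by move=> _ /mapP [p _ ->]; apply/zexpandP; exists p.
rewrite (fsbigE _ _ ur rI gr) big_seq_cond.
rewrite (eq_bigl [in r]) => [|J]; last first.
  by case: (boolP (J \in r)) => //= Jr; apply/mem_set/rI.
rewrite -big_seq big_map big_allpairs /=.
have row i : \sum_(j <- iota 0 N) g (zexpand I i j) = F i 0 - F i.+1 0.
  under eq_bigr do rewrite gE.
  (* Exposes the range as [index_iota 0 N], the form in which sums telescope. *)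
  rewrite -[iota 0 N](congr1 (iota 0) (subn0 N)).
  rewrite (GRing.Theory.telescope_sumr_eq (fun j => F i.+1 j - F i j)) //.
  by rewrite /F !(f0 _ N) ?leqnn ?orbT // subrr sub0r opprB.
under eq_bigr do rewrite row.
rewrite -[iota 0 N](congr1 (iota 0) (subn0 N)).
rewrite (GRing.Theory.telescope_sumr_eq (fun i => - F i 0)) // => [|i _].
  by rewrite {1}/F f0 ?leqnn // oppr0 sub0r opprK.
by rewrite opprK addrC.
Qed.

End Intervals.

(** * Subpartitions as formal sums of blocks *)

Section Subpartitions.
Variable X : finType.
Implicit Types (P Q : subpart X) (B : {set X}).

Lemma restr_set0 P : restr P finset.set0 = \bot%O.
Proof.
apply/val_inj/setP => B /=; rewrite !inE; apply/negP => /andP [/eqP B0].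
by move=> /imsetP [C _]; rewrite finset.setI0.
Qed.

Lemma restr_underlying P : restr P (underlying P) = P.
Proof.
have trace B : B \in blocks P -> B :&: underlying P = B.
  by move=> BP; apply/finset.setIidPl; apply: finset.bigcup_sup.
apply/val_inj/setP => B /=; rewrite !inE.
apply/andP/idP => [[_ /imsetP [C CP ->]]|BP]; first by rewrite trace.
have [x xB] := block_n0 BP.
split; first by apply/finset.set0Pn; exists x.
by apply/imsetP; exists B; rewrite ?trace.
Qed.

Lemma underlying_bot : underlying (\bot%O : subpart X) = finset.set0.
Proof. exact: big_set0. Qed.

Lemma underlying_eq0 P : underlying P = finset.set0 -> P = \bot%O.
Proof. by move=> P0; rewrite -[LHS]restr_underlying P0 restr_set0. Qed.

Lemma to_Zpow_bot : to_Zpow (\bot%O : subpart X) = 0.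
Proof. exact: big_set0. Qed.

Lemma coeff_to_Zpow P B : coeff B (to_Zpow P) = (B \in blocks P)%:R.
Proof.
rewrite /to_Zpow (big_morph (coeff B) (coeffD B) (coeff0 _ B)).
under eq_bigr do rewrite coeffU mul1r.
rewrite -natr_sum; congr (_%:R).
case: (boolP (B \in blocks P)) => BP.
  rewrite (big_setD1 B) //= eqxx big1 // => C; rewrite !inE => /andP [/negPf -> //].
by rewrite big1 // => C CP; case: eqP => // E; rewrite -E CP in BP.
Qed.

(** The coefficient of [B] is 1 or 0 according to whether [B] is a block, so the blocks can be read
    off. *)
Lemma to_Zpow_inj : injective (@to_Zpow X).
Proof.
move=> P Q E; apply/val_inj/setP => B /=.
have /(congr1 (coeff B)) := E; rewrite !coeff_to_Zpow.
by case: (B \in _); case: (B \in _).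
Qed.

End Subpartitions.

(** * Diamonds and clustergrams of formigrams *)

Section Formigrams.
Variables (R : realType) (X : finType).
Implicit Types (theta : R -> subpart X) (A : set R) (I J : zitv R).

(** Meet and join both run over the single value [P], and [P] restricted to its own underlying set
    is [P]. *)
Lemma diamond_constant theta A P :
  A !=set0 -> (forall t, A t -> theta t = P) -> diamond theta A = P.
Proof.
move=> [t At] AP.
have E Q : (Q \in theta @` A) = (Q == P).
  apply/idP/eqP => [/set_mem [s /AP <- <-] //|->].
  by apply/mem_set; exists t; rewrite ?AP.
by rewrite /diamond /bigmeet /bigjoin !(eq_bigl _ _ E) !big_pred1_eq restr_underlying.
Qed.

(** One empty value makes the meet empty, which leaves no underlying set on which blocks could have
    a trace. *)
Lemma diamond_bot theta A t : A t -> theta t = \bot%O -> diamond theta A = \bot%O.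
Proof.
move=> At tb.
have mb : bigmeet theta A = \bot%O.
  apply/eqP; rewrite -lex0 -tb; apply: meets_inf.
  by apply/mem_set; exists t.
by rewrite /diamond mb underlying_bot restr_set0.
Qed.

Lemma outside_support theta t :
  ~ formigram_support theta t -> theta t = \bot%O.
Proof.
move=> nt; apply: underlying_eq0; apply/setP => x; rewrite !inE.
by apply/negP => xt; apply: nt; exists x.
Qed.

Lemma dgm_second_difference theta :
  dgm theta = second_difference (fun J => to_Zpow (diamond theta J)).
Proof. by apply/funext => J; rewrite /dgm zleftU_zright. Qed.

Lemma sum_dgm theta I : bounded_set (formigram_support theta) ->
  finite_set [set J : zitv R | (I : set R) `<=` J /\ dgm theta J != 0] /\
  to_Zpow (diamond theta I) =
    \sum_(J \in [set J : zitv R | (I : set R) `<=` J]) dgm theta J.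
Proof.
move=> bnd; rewrite dgm_second_difference.
have [M HM] : exists M, forall t, formigram_support theta t -> `|t| <= M.
  have /pinfty_ex_gt0 [M _ HM] := bnd; by exists M.
have [N HN] := zexpand_escape I M.
apply: (mobius_inversion (N := N)) => i j /HN [s sJ Ms].
rewrite (diamond_bot sJ) ?to_Zpow_bot //.
by apply: outside_support => /HM; rewrite leNgt Ms.
Qed.

Lemma zitv_around theta t : critical_in_Z theta ->
  exists I, [/\ (I : set R) t, forall J, (J : set R) t -> (I : set R) `<=` J &
                forall s, (I : set R) s -> theta s = theta t].
Proof.
move=> [C [_ const _] CZ].
case: (boolP (t \is a Num.int)) => [zt|nzt].
  have p : is_zitv `[t, t] by rewrite /= zt; apply/asboolP; exists t; rewrite /= in_itv /= lexx.
  exists (Zitv p); rewrite /zset /=; split=> [|J Jt s|s].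
  - by rewrite in_itv /= lexx.
  - by rewrite /= itvxx => /eqP ->.
  - by rewrite /= itvxx => /eqP ->.
pose n : R := (Num.floor t)%:~R.
have zn : n \is a Num.int by exact: intr_int.
have nt : n < t < n + 1.
  have /andP [h1 h2] := floor_itv t; rewrite lt_neqAle h1 andbT.
  rewrite /n -intrD1 h2 andbT; apply: contraNneq nzt => <-; exact: intr_int.
have p : is_zitv `]n, n + 1[.
  by rewrite /= zn rpredD ?rpred1 //; apply/asboolP; exists t; rewrite /= in_itv.
(* Serves twice: no end of [J] lies in the gap, which gives minimality, and no critical point does,
   which gives constancy. *)
have gap c : c \is a Num.int -> n < c < n + 1 -> False.
  move=> /intrP [m ->]; rewrite /n -intrD1 !ltr_int ltzD1 => /andP [h1 h2].
  by have := lt_le_trans h1 h2; rewrite ltxx.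
exists (Zitv p); split=> [|J|s].
- by rewrite /zset /= in_itv.
- have [b [a [b' [c [E za zc _]]]]] := zitvP J.
  rewrite {1}/zset /= => tJ; apply/zsubP => /=; move: tJ; rewrite E /=.
  rewrite itv_boundlr => /andP [h1 h2].
  have an : a <= n.
    rewrite leNgt; apply/negP => na; apply: (gap a za); rewrite na /=.
    have : a <= t by case: b h1 {E}; rewrite bnd_simp // => /ltW.
    by move=> /le_lt_trans; apply; case/andP: nt.
  have nc : n + 1 <= c.
    rewrite leNgt; apply/negP => na; apply: (gap c zc); rewrite na andbT.
    have : t <= c by case: b' h2 {E}; rewrite bnd_simp // => /ltW.
    by apply: lt_le_trans; case/andP: nt.
  (* As the unit interval is open, weak inequalities suffice for closed and open ends of [J]
     alike. *)
  by case: (b); case: (b'); rewrite !bnd_simp ?an ?nc.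
- move=> sI; apply: const.
  (* The open unit interval is connected and avoids [C], so it lies in one component of the
     complement. *)
  apply: (@connected_component_max _ _ [set` `]n, n + 1[]) => //.
  + by move=> u /= uI /CZ zu; apply: (gap u zu); rewrite in_itv in uI.
  + by apply/connected_intervalP/interval_is_interval.
Qed.

Lemma sum_dgm_at theta t : bounded_set (formigram_support theta) ->
  critical_in_Z theta ->
  finite_set [set J : zitv R | (J : set R) t /\ dgm theta J != 0] /\
  to_Zpow (theta t) = \sum_(J \in [set J : zitv R | (J : set R) t]) dgm theta J.
Proof.
move=> bnd /(zitv_around t) [I [It sub const]].
(* Minimality of [I] turns the sum over [J] containing [t] into the sum over [J] containing [I]. *)
have IJ J : (J : set R) t = ((I : set R) `<=` J).
  by apply/propext; split=> [/sub //|]; exact.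
rewrite -(diamond_constant (ex_intro _ t It) const).
under eq_set do rewrite IJ.
under [X in \sum_(J \in X) _]eq_set do rewrite IJ.
exact: sum_dgm.
Qed.

End Formigrams.

Theorem mainTheorem1 (R : realType) (X : finType) (X_nonempty : (0 < #|X|)%N) :
  (forall theta : R -> subpart X,
     formigram theta -> bounded_set (formigram_support theta) -> critical_in_Z theta ->
     (* [\sum_(J \in A)] is 0 by convention when infinitely many terms are nonzero,
        so the finiteness of the support is asserted alongside each identity. *)
     (forall I : zitv R,
        finite_set [set J : zitv R | (I : set R) `<=` J /\ dgm theta J != 0]
        /\ to_Zpow (diamond theta I) =
           \sum_(J \in [set J : zitv R | (I : set R) `<=` J]) dgm theta J)
     /\
     (forall t : R,
        finite_set [set J : zitv R | (J : set R) t /\ dgm theta J != 0]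
        /\ to_Zpow (theta t) =
           \sum_(J \in [set J : zitv R | (J : set R) t]) dgm theta J))
  /\
  (forall theta theta' : R -> subpart X,
     formigram theta -> bounded_set (formigram_support theta) -> critical_in_Z theta ->
     formigram theta' -> bounded_set (formigram_support theta') -> critical_in_Z theta' ->
     dgm theta = dgm theta' -> theta = theta').
Proof.
split=> [theta _ bnd crit|theta theta' _ bnd crit _ bnd' crit' E].
  by split=> [I|t]; [apply: sum_dgm|apply: sum_dgm_at].
apply/funext => t; apply: to_Zpow_inj.
by rewrite (sum_dgm_at t bnd crit).2 (sum_dgm_at t bnd' crit').2 E.
Qed.
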